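(* (I) Let $A\in\mathbb{C}^{n\times n}$ be a matrix whose spectrum avoids the imaginary axis. Then there exists a finite $\eta>1$ such that $$\mathrm{spec}(A)\subset -\mathbb{D}_{\rm inv}(\eta)\,\cup\,\mathbb{D}_{\rm inv}(\eta).$$ Furthermore, with this $\eta$, for all $j=0,1,2,\ldots$, $$\mathrm{spec}(h_j(A))\subset -\mathbb{D}_{\rm inv}(h_j(\eta))\,\cup\,\mathbb{D}_{\rm inv}(h_j(\eta)).$$ (II) For every $\eta\in(1,\infty]$, $$\mathcal{C}\left(\mathbb{D}_{\rm inv}\left(\tfrac12\left(\eta+\tfrac1\eta\right)\right)\right)=-\left(\{z\in\mathbb{C}:|z|<\sqrt{\tfrac{\eta-1}{\eta+1}}\}\right)^2,$$ and more generally, for $j=0,1,2,\ldots$, $$\mathcal{C}\left(\mathbb{D}_{\rm inv}(h_j(\eta))\right)=(-1)^j\cdot\left\{z\in\mathbb{C}:|z|<\left(\sqrt{\tfrac{\eta-1}{\eta+1}}\right)^{2^j}\right\}.$$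
   Context: For $\eta\in(1,\infty)$, $\mathbb{D}_{\rm inv}(\eta)=\{z\in\mathbb{C}:|z-\eta|<\sqrt{\eta^2-1}\}$, the open disk with center $\eta$ and radius $\sqrt{\eta^2-1}$; for $\eta=\infty$ it is understood as the limit, the open right half-plane $\{\mathrm{Re}(z)>0\}$. For $\eta=\infty$, $\frac{\eta-1}{\eta+1}$ is read as $1$ and $h_j(\infty)=\infty$. The Newton iteration is $h_0(x)=x$, $h_j(x)=\frac12\left(h_{j-1}(x)+\frac{1}{h_{j-1}(x)}\right)$ for $j=1,2,\ldots$; for a matrix $A$, $h_0(A)=A$ and $h_j(A)=\frac12\left(h_{j-1}(A)+h_{j-1}(A)^{-1}\right)$. $\mathcal{C}$ is the Cayley transform, $\mathcal{C}(c)=\frac{1-c}{1+c}$ for complex $c\ne -1$, and $\mathcal{C}(D)=\{\mathcal{C}(c):c\in D\}$ for a set $D$. Operations on sets of complex numbers (negation, square, multiplication by a scalar) are element-wise. *)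

(* Defs.v *)
From HB Require Import structures.
From mathcomp Require Import all_boot all_order all_algebra.
From mathcomp Require Import classical_sets reals constructive_ereal.
From mathcomp Require Export complex.

Set Implicit Arguments.
Unset Strict Implicit.
Unset Printing Implicit Defensive.

Import Order.TTheory GRing.Theory Num.Theory.
Local Open Scope classical_set_scope.
Local Open Scope complex_scope.
Local Open Scope ring_scope.

(* The norm `|z| of a complex number z : R[i] is itself an element of R[i]
   (with zero imaginary part), so real radii are embedded by _%:C. *)
Definition open_disk (R : realType) (c : R[i]) (r : R) : set R[i] :=
  [set z | `|z - c| < r%:C].

(* The parameter eta ranges over (1, +oo] in the extended reals; the -oo
   branches below are never used. *)
Definition Dinv (R : realType) (eta : \bar R) : set R[i] :=
  match eta with
  | e%:E => open_disk e%:C (Num.sqrt (e ^+ 2 - 1))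
  | +oo%E => [set z | 0 < complex.Re z]
  | -oo%E => set0
  end.

Fixpoint newton (F : fieldType) (j : nat) (x : F) : F :=
  if j is j'.+1 then 2%:R^-1 * (newton j' x + (newton j' x)^-1) else x.

(* The value at +oo is h_j(oo) = oo for every j. *)
Definition newton_ext (R : realType) (j : nat) (eta : \bar R) : \bar R :=
  match eta with
  | e%:E => (newton j e)%:E
  | +oo%E => +oo%E
  | -oo%E => -oo%E
  end.

(* invmx is total (invmx A = A for singular A), but singular iterates cannot
   satisfy an inclusion of the spectrum in - Dinv e `|` Dinv e with e > 1,
   as neither disk contains 0. *)
Fixpoint newton_mx (F : fieldType) (n j : nat) (A : 'M[F]_n) : 'M[F]_n :=
  if j is j'.+1 then 2%:R^-1 *: (newton_mx j' A + invmx (newton_mx j' A))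
  else A.

Definition spec (F : fieldType) (n : nat) (A : 'M[F]_n) : set F :=
  [set a | eigenvalue A a].

Definition imaginary_axis (R : realType) : set R[i] :=
  [set z | complex.Re z = 0].

(* At c = -1 this takes the junk value 0; it is only applied to sets Dinv eta
   with eta > 1, which lie in the open right half-plane. *)
Definition cayley (R : realType) (c : R[i]) : R[i] := (1 - c) / (1 + c).

Definition eta_ratio (R : realType) (eta : \bar R) : R :=
  match eta with
  | e%:E => (e - 1) / (e + 1)
  | +oo%E => 1
  | -oo%E => 0
  end.

Definition set_scale (F : fieldType) (a : F) (D : set F) : set F :=
  [set a * z | z in D].
Definition set_opp (F : fieldType) (D : set F) : set F := [set - z | z in D].
Definition set_sqr (F : fieldType) (D : set F) : set F := [set z ^+ 2 | z in D].

(* Main.v *)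
Require Import Defs.
From mathcomp Require Import all_boot all_order all_algebra.
From mathcomp Require Import ring lra.
From mathcomp Require Import classical_sets reals constructive_ereal.

Import Order.TTheory GRing.Theory Num.Theory.
Local Open Scope classical_set_scope.
Local Open Scope complex_scope.
Local Open Scope ring_scope.

(* A complex [z] lies in [Dinv e] iff [|z|^2 + 1 < 2 e Re z].  Part (I) is then
   a polynomial inequality for a scalar Newton step, combined with the spectral
   mapping property of [z |-> (z + z^-1) / 2].  For part (II), the Cayley
   transform is an involution carrying this condition to
   [|w|^2 < (e - 1) / (e + 1)], and a Newton step squares [(e - 1) / (e + 1)]. *)

(** * Spectral mapping for one Newton step on a matrix *)

Section Spectrum.

Set Implicit Arguments.
Unset Strict Implicit.

Variables (F : closedFieldType) (n : nat).
Implicit Type A : 'M[F]_n.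

(** The characteristic polynomial splits over a closed field; listing the eigenvalues lets a single
    [eta] be chosen for all of them. *)
Lemma eigenvalue_seq A : {r : seq F | forall a, eigenvalue A a = (a \in r)}.
Proof.
have [r Er] := closed_field_poly_normal (char_poly A).
exists r => a; rewrite eigenvalue_root_char Er rootZ ?root_prod_XsubC //.
by rewrite lead_coef_eq0 monic_neq0 // char_poly_monic.
Qed.

Lemma unitmx_eigenvalue0 A : (A \in unitmx) = ~~ eigenvalue A 0.
Proof.
by rewrite -row_free_unit -kermx_eq0 /eigenvalue /eigenspace raddf0 subr0 negbK.
Qed.

(* [x] and [b *+ 2 - x] are the roots of [X^2 - 2 b X + 1], and [v] is killed
   by [B^2 - 2 b B + 1 = (B - x) (B - (2 b - x))], so one of the two factors
   is singular. *)
Lemma eigenvalue_newton_step (B : 'M[F]_n) (b : F) :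
    B \in unitmx -> 2%:R != 0 :> F ->
    eigenvalue (2%:R^-1 *: (B + invmx B)) b ->
  exists2 a, eigenvalue B a & b = 2%:R^-1 * (a + a^-1).
Proof.
move=> uB nz2 /eigenvalueP[v Ev nzv].
have vB : v *m B *m B + v = (b *+ 2) *: (v *m B).
  have /(congr1 (fun u => 2%:R *: (u *m B))) := Ev.
  rewrite -scalemxAr -scalemxAl scalerA divff // scale1r mulmxDr mulmxDl.
  by rewrite (mulmxKV uB) -scalemxAl scalerA mulr_natl.
have [x /eqP x_root] : exists x, x ^+ 2 - (b *+ 2) * x + 1 == 0.
  have [x Ex] := @solve_monicpoly F 2 (fun i => if i == 0 then -1 else b *+ 2) isT.
  exists x; rewrite Ex big_ord_recl big_ord1 /= expr0 expr1; apply/eqP; ring.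
(* Invertibility of [B] makes [y] nonzero, so the quadratic can be divided by [2 y]. *)
have main y : eigenvalue B y -> y ^+ 2 - (b *+ 2) * y + 1 = 0 ->
    exists2 a, eigenvalue B a & b = 2%:R^-1 * (a + a^-1).
  move=> By Ey; exists y => //.
  have nzy : y != 0.
    by apply: contraTneq uB => y0; rewrite unitmx_eigenvalue0 negbK -y0.
  apply: (mulfI nzy); apply: (mulfI nz2).
  have -> : 2%:R * (y * (2%:R^-1 * (y + y^-1))) = y ^+ 2 + 1.
    by field; rewrite nz2 nzy.
  apply/eqP; rewrite eq_sym -subr_eq0 -[X in _ == X]Ey; apply/eqP; ring.
(* Unless [v] is already an eigenvector for [x], the nonzero vector [v *m B - x *: v] is one for
   [b *+ 2 - x]. *)
have [/eqP vx | nzu] := eqVneq (v *m B - x *: v) 0.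
  apply: (main x) => //; apply/eigenvalueP; exists v => //.
  by apply/eqP; rewrite -subr_eq0.
apply: (main (b *+ 2 - x)); last by rewrite -[RHS]x_root; ring.
apply/eigenvalueP; exists (v *m B - x *: v) => //.
have -> : (v *m B - x *: v) *m B = (b *+ 2) *: (v *m B) - v - x *: (v *m B).
  by rewrite mulmxBl -vB addrK scalemxAl.
have -> : (b *+ 2 - x) *: (v *m B - x *: v)
    = (b *+ 2) *: (v *m B) - x *: (v *m B) - ((b *+ 2 - x) * x) *: v.
  by rewrite scalerBr scalerA scalerBl.
have -> : (b *+ 2 - x) * x = 1.
  by apply/eqP; rewrite -subr_eq0 -oppr_eq0 -x_root; apply/eqP; ring.
by rewrite scale1r addrAC.
Qed.

End Spectrum.

(** * The disks under the scalar Newton step *)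

Section Disks.

Set Implicit Arguments.
Unset Strict Implicit.

Variable R : realType.
Implicit Types (x y r e : R) (z w : R[i]) (eta : \bar R).

(** Squaring trades the norm, valued in [R[i]], for a real polynomial inequality within reach of
    [nra]. *)
Lemma open_diskP c r z : 0 <= r ->
  open_disk c r z <->
  (complex.Re z - complex.Re c) ^+ 2 + (complex.Im z - complex.Im c) ^+ 2 < r ^+ 2.
Proof.
case: c z => [a b] [x y] r0; rewrite /open_disk /mkset normc_def ltcR /=.
set s := (_ ^+ 2 + _).
have s0 : 0 <= s by rewrite addr_ge0 ?sqr_ge0.
by rewrite -[in X in _ <-> X](sqr_sqrtr s0) ltr_pXn2r ?nnegrE ?sqrtr_ge0.
Qed.

Lemma Dinv_finP e z : 1 < e ->
  Dinv e%:E z <->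
  complex.Re z ^+ 2 + complex.Im z ^+ 2 + 1 < 2%:R * e * complex.Re z.
Proof.
move=> e1; rewrite /Dinv open_diskP ?sqrtr_ge0 // sqr_sqrtr; last by nra.
by case: z => x y /=; split; nra.
Qed.

Lemma Dinv_Re_gt0 eta z : (1%:E < eta)%E -> Dinv eta z -> 0 < complex.Re z.
Proof.
case: eta => [e||] //; rewrite lte_fin => e1.
by rewrite (Dinv_finP _ e1); case: z => x y /=; nra.
Qed.

Lemma newton_gt1 j e : 1 < e -> 1 < newton j e.
Proof.
move=> e1; elim: j => //= j; move: (newton j e) => h h1.
have h0 : h != 0 by lra.
have -> : 2%:R^-1 * (h + h^-1) = 1 + (h - 1) ^+ 2 / (2%:R * h) by field.
by rewrite ltrDl divr_gt0 ?exprn_gt0 ?mulr_gt0 //; lra.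
Qed.

Lemma newton_stepN z : 2%:R^-1 * (- z + (- z)^-1) = - (2%:R^-1 * (z + z^-1)).
Proof. by rewrite invrN -opprD mulrN. Qed.

(* Writing [s = |z|^2 + 1] and [t = 2 Re z], the claim amounts to
   [(s - e t) (s - t / e) < 0]. *)
Lemma Dinv_newton_step e z : 1 < e -> Dinv e%:E z ->
  Dinv (2%:R^-1 * (e + e^-1))%:E (2%:R^-1 * (z + z^-1)).
Proof.
move=> e1; have he1 := newton_gt1 1 e1.
rewrite (Dinv_finP _ e1) (Dinv_finP _ he1).
case: z => x y; rewrite [complex.Re (x +i* y)]/= [complex.Im (x +i* y)]/= => H.
have x0 : 0 < x by nra.
set N := x ^+ 2 + y ^+ 2.
have N0 : 0 < N by rewrite /N; nra.
have nzN : x ^+ 2 + y ^+ 2 != 0 by rewrite gt_eqF.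
have -> : 2%:R^-1 * ((x +i* y) + (x +i* y)^-1)
    = (x * (N + 1) / (2%:R * N)) +i* (y * (N - 1) / (2%:R * N)).
  apply: (@mulfI _ 2%:R); rewrite ?pnatr_eq0 // mulVKf ?pnatr_eq0 // mulr_natl mulr2n.
  by rewrite /N; apply/eqP; rewrite eq_complex /=; apply/andP; split; apply/eqP; field.
set s := N + 1; set t := 2%:R * x.
have e0 : e != 0 by lra.
have st : s - e * t < 0 by rewrite /s /t /N; nra.
(* Here [t / e < t], and [s - t = (x - 1)^2 + y^2] is nonnegative. *)
have st' : 0 < s - t / e.
  have te : t / e < t by rewrite ltr_pdivrMr /t; nra.
  by rewrite subr_gt0; apply: lt_le_trans te _; rewrite /s /t /N;
    have := sqr_ge0 (x - 1); nra.
(* For the image point [w], [|w|^2 + 1 = (s^2 + t^2) / (4 N)] and [Re w = s t / (4 N)], so this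
   quotient is the difference of the two sides of the disk condition. *)
have key : (s - e * t) * (s - t / e) / (2%:R ^+ 2 * N) < 0.
  by rewrite pmulr_llt0 ?invr_gt0 ?mulr_gt0 ?exprn_gt0 ?ltr0n // nmulr_rlt0.
rewrite -subr_lt0; apply: le_lt_trans key.
rewrite le_eqVlt; apply/orP; left; apply/eqP.
rewrite /s /t /N /=; field.
by rewrite e0 nzN.
Qed.

(** The Newton step is odd, so the reflected disk reduces to the disk itself. *)
Lemma Dinv_opp_newton_step e z : 1 < e ->
  (set_opp (Dinv e%:E) `|` Dinv e%:E) z ->
  (set_opp (Dinv (2%:R^-1 * (e + e^-1))%:E)
     `|` Dinv (2%:R^-1 * (e + e^-1))%:E) (2%:R^-1 * (z + z^-1)).
Proof.
move=> e1 [[w Dw <-] | Dz]; last by right; apply: Dinv_newton_step.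
left; exists (2%:R^-1 * (w + w^-1)); last by rewrite newton_stepN.
exact: Dinv_newton_step.
Qed.

(** Both disks avoid the imaginary axis; this is what keeps the Newton iterates of the matrix
    invertible. *)
Lemma Dinv_opp_neq0 e : 1 < e -> ~ (set_opp (Dinv e%:E) `|` Dinv e%:E) 0.
Proof.
move=> e1 [[w Dw /eqP]|/Dinv_Re_gt0]; last by rewrite lte_fin ltxx => /(_ e1).
by rewrite oppr_eq0 => /eqP w0; have := @Dinv_Re_gt0 e%:E w e1 Dw; rewrite w0 ltxx.
Qed.

Lemma Dinv_opp_exists (r : seq R[i]) :
  {in r, forall z, complex.Re z != 0} ->
  exists e, 1 < e /\ {in r, forall z, (set_opp (Dinv e%:E) `|` Dinv e%:E) z}.
Proof.
move=> nzr.
(* [g z] is the threshold that [e > 1] must exceed for one of the two disks to contain [z]. *)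
pose g z := (complex.Re z ^+ 2 + complex.Im z ^+ 2 + 1) / (2%:R * `|complex.Re z|).
have g0 z : 0 <= g z.
  by rewrite divr_ge0 ?mulr_ge0 ?addr_ge0 ?sqr_ge0.
(* A sum of nonnegative thresholds dominates each of them; the added 2 gives strictness and
   [1 < e]. *)
pose e := 2%:R + \sum_(z <- r) g z.
have e1 : 1 < e.
  have : 0 <= \sum_(z <- r) g z by apply: sumr_ge0.
  by rewrite /e; lra.
exists e; split=> // z rz.
have ge : g z < e.
  rewrite /e (big_rem z) //=.
  have : 0 <= \sum_(y <- rem z r) g y by apply: sumr_ge0.
  lra.
have nzz := nzr z rz.
move: ge; rewrite /g ltr_pdivrMr ?mulr_gt0 ?normr_gt0 ?ltr0n // mulrA (mulrC e).
have [z0|z0] := ltP 0 (complex.Re z) => ge.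
  by right; rewrite (Dinv_finP _ e1) -{2}(gtr0_norm z0).
left; exists (- z); last exact: opprK.
rewrite (Dinv_finP _ e1); move: ge z0; rewrite /= => ge z0.
by case: z {rz nzz} ge z0 => x y /= ge z0; move: ge; rewrite ler0_norm // !sqrrN.
Qed.

(** * The Cayley transform of the disks *)

Lemma cayleyK z : 1 + z != 0 -> cayley (cayley z) = z.
Proof.
move=> nz; rewrite /cayley.
have n2 : 2%:R != 0 :> R[i] by rewrite pnatr_eq0.
have -> : 1 - (1 - z) / (1 + z) = 2%:R * z / (1 + z) by field.
have -> : 1 + (1 - z) / (1 + z) = 2%:R / (1 + z) by field.
by field; rewrite nz.
Qed.

Lemma cayleyD1_neq0 z : 1 + z != 0 -> 1 + cayley z != 0.
Proof.
move=> nz; have -> : 1 + cayley z = 2%:R / (1 + z) by rewrite /cayley; field.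
by rewrite mulf_neq0 ?invr_neq0 // pnatr_eq0.
Qed.

Lemma sqr_norm1D_gt0 x y :
  1 + (x +i* y) != 0 -> 0 < (1 + x) ^+ 2 + y ^+ 2.
Proof.
move=> nz; rewrite lt_neqAle addr_ge0 ?sqr_ge0 // andbT eq_sym.
apply: contraNneq nz => /eqP.
rewrite paddr_eq0 ?sqr_ge0 // !sqrf_eq0 => /andP[x0 y0].
by rewrite eq_complex /= add0r x0 y0.
Qed.

(** The fraction is expanded by the conjugate of its denominator. *)
Lemma cayleyE x y : 1 + (x +i* y) != 0 ->
  cayley (x +i* y) =
    ((1 - x ^+ 2 - y ^+ 2) / ((1 + x) ^+ 2 + y ^+ 2))
    +i* (- (2%:R * y / ((1 + x) ^+ 2 + y ^+ 2))).
Proof.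
move=> /sqr_norm1D_gt0/lt0r_neq0 nzd.
apply/eqP; rewrite eq_complex /= !add0r; apply/andP; split; apply/eqP; field.
all: by rewrite nzd.
Qed.

Lemma eta_ratio_ge0 eta : (1%:E < eta)%E -> 0 <= eta_ratio eta.
Proof.
by case: eta => [e||] //=; rewrite lte_fin => e1; rewrite divr_ge0 //; lra.
Qed.

Lemma eta_ratio_le1 eta : (1%:E < eta)%E -> eta_ratio eta <= 1.
Proof.
by case: eta => [e||] //=; rewrite lte_fin => e1; rewrite ler_pdivrMr; lra.
Qed.

(* Multiplying the condition of [Dinv_finP] by [|1 + w|^2] gives
   [|1 - w|^2 + |1 + w|^2 < 2 e (1 - |w|^2)], i.e. [|w|^2 (e + 1) < e - 1]. *)
Lemma Dinv_cayley eta w : (1%:E < eta)%E -> 1 + w != 0 ->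
  Dinv eta (cayley w) <-> open_disk 0 (Num.sqrt (eta_ratio eta)) w.
Proof.
move=> eta1; rewrite open_diskP ?sqrtr_ge0 // sqr_sqrtr ?eta_ratio_ge0 //.
case: w => x y nz; rewrite (cayleyE nz) /= !subr0.
have d0 := sqr_norm1D_gt0 nz.
have dn0 := lt0r_neq0 d0.
case: eta eta1 => [e||] //; last first.
  by move=> _; rewrite /= pmulr_lgt0 ?invr_gt0 //; split; lra.
rewrite lte_fin => e1; rewrite (Dinv_finP _ e1) /= ltr_pdivlMr; last by lra.
rewrite -subr_lt0.
set u := (X in X < 0).
have -> : u = ((x ^+ 2 + y ^+ 2) * (e + 1) - (e - 1)) * (2%:R / ((1 + x) ^+ 2 + y ^+ 2)).
  by rewrite /u; field.
by rewrite pmulr_llt0 ?divr_gt0 ?ltr0n // subr_lt0.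
Qed.

(** Away from -1 the Cayley transform is its own inverse, so the image is a preimage. The pole is
    avoided on both sides: [Dinv eta] has positive real parts, and the centred disk is open of
    radius at most 1. *)
Lemma cayley_Dinv eta : (1%:E < eta)%E ->
  [set cayley c | c in Dinv eta] = open_disk 0 (Num.sqrt (eta_ratio eta)).
Proof.
move=> eta1; apply/seteqP; split=> [_ [c Dc <-] | w Dw].
  have nzc : 1 + c != 0.
    have := Dinv_Re_gt0 eta1 Dc; apply: contraTneq => /eqP.
    by case: c {Dc} => x y; rewrite eq_complex /= => /andP[/eqP ? _]; rewrite -leNgt; lra.
  by apply/(Dinv_cayley eta1 (cayleyD1_neq0 nzc)); rewrite cayleyK.
have nzw : 1 + w != 0.
  apply/eqP => /eqP; move: Dw; rewrite open_diskP ?sqrtr_ge0 // sqr_sqrtr ?eta_ratio_ge0 //.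
  have := eta_ratio_le1 eta1; move: (eta_ratio eta) => rho {eta1}.
  by case: w => x y; rewrite eq_complex /= => ? ? /andP[/eqP ? /eqP ?]; nra.
by exists (cayley w); [apply/Dinv_cayley | apply: cayleyK].
Qed.

(** * Squares, signs and Newton iterates for the centred disks *)

Lemma open_disk0E r z : open_disk 0 r z = (`|z| < r%:C).
Proof. by rewrite /open_disk /mkset subr0. Qed.

(** Every [- w] has a complex square root, and negation preserves the modulus. *)
Lemma set_opp_sqr_disk r : 0 <= r ->
  set_opp (set_sqr (open_disk 0 r)) = open_disk (0 : R[i]) (r ^+ 2).
Proof.
move=> r0; have rC0 : 0 <= r%:C by rewrite ler0c.
have sqr_lt z : (`|z ^+ 2| < (r ^+ 2)%:C) = (`|z| < r%:C).
  by rewrite rmorphXn normrX ltr_pXn2r ?nnegrE ?normr_ge0.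
apply/seteqP; split=> [_ [_ [z + <-] <-] | w]; rewrite !open_disk0E.
  by rewrite normrN sqr_lt.
move=> wr; exists (- w); last exact: opprK.
exists (sqrtc (- w)); last exact: sqr_sqrtc.
by rewrite open_disk0E -sqr_lt sqr_sqrtc normrN.
Qed.

Lemma set_scale_sign_disk j r :
  set_scale ((-1) ^+ j) (open_disk (0 : R[i]) r) = open_disk 0 r.
Proof.
have norm_sign z : `|(-1) ^+ j * z| = `|z|.
  by rewrite normrM normrX normrN1 expr1n mul1r.
apply/seteqP; split=> [_ [z + <-] | z]; rewrite !open_disk0E ?norm_sign //.
by move=> zr; exists ((-1) ^+ j * z); rewrite ?signrMK // open_disk0E norm_sign.
Qed.

Lemma newton_ext_gt1 j eta : (1%:E < eta)%E -> (1%:E < newton_ext j eta)%E.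
Proof. by case: eta => [e||] //; rewrite !lte_fin; apply: newton_gt1. Qed.

(** If [h'] is the Newton step of [h], then [h' - 1 = (h - 1)^2 / (2 h)] and
    [h' + 1 = (h + 1)^2 / (2 h)]. *)
Lemma eta_ratio_newton_ext j eta : (1%:E < eta)%E ->
  eta_ratio (newton_ext j eta) = eta_ratio eta ^+ (2 ^ j).
Proof.
case: eta => [e||] //=; last by rewrite expr1n.
rewrite lte_fin => e1; elim: j => //= j IHj.
rewrite expnS mulnC exprM -IHj; have := newton_gt1 j e1.
move: (newton j e) => h h1; field.
by rewrite !gt_eqF //; nra.
Qed.

Lemma cayley_Dinv_newton_ext j eta : (1%:E < eta)%E ->
  [set cayley c | c in Dinv (newton_ext j eta)] =
    open_disk 0 (Num.sqrt (eta_ratio eta) ^+ (2 ^ j)).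
Proof.
move=> eta1; rewrite (cayley_Dinv (newton_ext_gt1 j eta1)) eta_ratio_newton_ext //.
congr open_disk; rewrite -[in LHS](sqr_sqrtr (eta_ratio_ge0 eta1)) exprAC sqrtr_sqr.
by rewrite ger0_norm // exprn_ge0 // sqrtr_ge0.
Qed.

(** Extended-real inversion sends [+oo] to 0, so the explicit formula also fixes [+oo]. *)
Lemma newton_ext1 eta : (1%:E < eta)%E ->
  newton_ext 1 eta = ((2^-1)%:E * (eta + eta^-1))%E.
Proof.
case: eta => [e||] //=; last by rewrite invey adde0 gt0_muley // lte_fin invr_gt0 ltr0n.
by rewrite lte_fin => e1; rewrite inver gt_eqF //; lra.
Qed.

End Disks.

Theorem mainTheorem2 (R : realType) :
  (forall (n : nat) (A : 'M[R[i]]_n),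
     spec A `&` @imaginary_axis R = set0 ->
     (exists eta : R, 1 < eta /\
        spec A `<=` set_opp (Dinv eta%:E) `|` Dinv eta%:E) /\
     (forall eta : R, 1 < eta ->
        spec A `<=` set_opp (Dinv eta%:E) `|` Dinv eta%:E ->
        forall j : nat,
          spec (newton_mx j A) `<=`
            set_opp (Dinv (newton j eta)%:E) `|` Dinv (newton j eta)%:E))
  /\
  (forall eta : \bar R, (1%:E < eta)%E ->
     [set cayley c | c in Dinv ((2^-1)%:E * (eta + eta^-1))%E] =
       set_opp (set_sqr (open_disk 0 (Num.sqrt (eta_ratio eta)))) /\
     (forall j : nat,
        [set cayley c | c in Dinv (newton_ext j eta)] =
          set_scale ((-1) ^+ j)
            (open_disk 0 (Num.sqrt (eta_ratio eta) ^+ (2 ^ j))))).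
Proof.
split=> [n A specA | eta eta1]; last first.
  split=> [|j]; last by rewrite set_scale_sign_disk cayley_Dinv_newton_ext.
  (* The first identity is the case [j = 1], where the exponent [2 ^ 1] computes to 2. *)
  by rewrite -newton_ext1 // cayley_Dinv_newton_ext // set_opp_sqr_disk ?sqrtr_ge0.
split=> [|e e1 specAe].
  have [r Er] := eigenvalue_seq A.
  have nzr : {in r, forall z, complex.Re z != 0}.
    move=> z; rewrite -Er => Az; apply/eqP => z0.
    by have : (spec A `&` @imaginary_axis R) z by []; rewrite specA.
  have [e [e1 De]] := Dinv_opp_exists nzr.
  by exists e; split=> // z Az; apply: De; rewrite -Er.
elim=> [|j IHj b]; first exact: specAe.
have ej1 := newton_gt1 j e1.
(* The inclusion for step [j] excludes the eigenvalue 0, so [invmx] is a true inverse here. *)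
have unitj : newton_mx j A \in unitmx.
  rewrite unitmx_eigenvalue0; apply/negP => ev0.
  exact: (Dinv_opp_neq0 ej1 (IHj 0 ev0)).
rewrite /spec /= => /(eigenvalue_newton_step unitj); rewrite pnatr_eq0 => /(_ isT).
case=> a Aa ->; exact: (Dinv_opp_newton_step ej1 (IHj a Aa)).
Qed.
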